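(* There exist universal constants $C>c>0$ such that the following holds. Fix $d,n\in\mathbb{N}$, a real $R_0\ge 1$ and $\mathbf v^*\in\mathbb{S}^{d-1}$. If $n\ge CR_0$, then $$\inf_{\tilde R}\ \sup_{R\in[R_0,2R_0]}\mathbb{E}_{R\mathbf v^*}\big|\tilde R-R\big|\ \ge\ c\sqrt{\frac{R_0^3}{n}},$$ where the infimum is over all estimators $\tilde R=\tilde R\big((\mathbf x_i,y_i)_{i=1}^n,\mathbf v^*\big)$, i.e. all measurable real-valued functions of the data which may also depend on the (known) direction $\mathbf v^*$.
   Context: Logistic regression with Gaussian design: for $\boldsymbol\theta\in\mathbb{R}^d$, $\mathbb{E}_{\boldsymbol\theta}$ denotes expectation when $(\mathbf x_1,y_1),\dots,(\mathbf x_n,y_n)$ are i.i.d. with $\mathbf x_i\sim N(\mathbf 0,\mathbf I_d)$ and $y_i\mid\mathbf x_i\sim\mathrm{Bernoulli}(s(\mathbf x_i^\top\boldsymbol\theta))$, where $s(a)=(1+e^{-a})^{-1}$. $\mathbb{S}^{d-1}$ is the Euclidean unit sphere in $\mathbb{R}^d$. ''Universal constant'' means a constant not depending on any parameter ($n,d,R_0,\mathbf v^*$). *)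

(* Defs.v *)
From HB Require Import structures.
From mathcomp Require Import all_boot all_order all_algebra.
From mathcomp Require Import all_classical all_reals all_analysis.
From mathcomp Require Import measurable_realfun.

Set Implicit Arguments.
Unset Strict Implicit.
Unset Printing Implicit Defensive.

Import Order.TTheory GRing.Theory Num.Theory.
Import numFieldNormedType.Exports.

Local Open Scope classical_set_scope.
Local Open Scope ring_scope.

(* Covariates live in a tuple type, which carries the product Borel
   sigma-algebra; parameters live in 'rV[R]_d. *)
Notation covariate R d := (d.-tuple (measurableTypeR R)).
Notation observation R d := (covariate R d * bool)%type.

Section iid.
Context {d} {T : measurableType d} {R : realType}.

Definition cons_pair n (x : T * n.-tuple T) : n.+1.-tuple T :=
  [the n.+1.-tuple T of x.1 :: x.2].

Lemma measurable_cons_pair n : measurable_fun setT (@cons_pair n).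
Proof. exact: measurable_cons. Qed.

HB.instance Definition _ n :=
  isMeasurableFun.Build _ _ _ _ (@cons_pair n) (@measurable_cons_pair n).

(* The n-fold product P \x ... \x P, transported to n.-tuple T. *)
Fixpoint iid (P : probability T R) n : probability (n.-tuple T) R :=
  match n with
  | 0 => dirac [tuple]
  | m.+1 => distribution (P \x iid P m)%E (@cons_pair m)
  end.

End iid.

Section logistic_model.
Context {R : realType} (d : nat).

Definition logistic (a : R) : R := (1 + expR (- a))^-1.

Definition dotp (x : covariate R d) (theta : 'rV[R]_d) : R :=
  \sum_(i < d) (tnth x i : R) * theta ord0 i.

(* The library norm on 'rV[R]_d is the sup norm. *)
Definition l2norm (v : 'rV[R]_d) : R := Num.sqrt (\sum_(i < d) v ord0 i ^+ 2).

Definition std_gaussian : probability (covariate R d) R :=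
  iid (normal_prob (0 : R) 1) d.

Section observation_law.
Variable theta : 'rV[R]_d.

Definition label_prob (x : covariate R d) : pprobability bool R :=
  bernoulli_prob (logistic (dotp x theta)).

Lemma measurable_logistic : measurable_fun setT logistic.
Proof.
apply: continuous_measurable_fun => a; apply: cvgV.
  by rewrite gt_eqF// ltr_wpDr// expR_ge0.
apply: cvgD; first exact: cvg_cst.
by apply: (@continuous_comp _ _ _ -%R expR); [exact: opp_continuous|exact: continuous_expR].
Qed.

Lemma measurable_dotp : measurable_fun setT (dotp ^~ theta).
Proof.
apply: measurable_sum => i; apply: measurable_funM => //.
exact: measurable_tnth.
Qed.

Lemma measurable_label_prob : measurable_fun setT label_prob.
Proof.
apply: measurableT_comp; first exact: measurable_bernoulli_prob.
apply: measurableT_comp; [exact: measurable_logistic|exact: measurable_dotp].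
Qed.

(* Joint law of (x, y) with x ~ N(0, I_d) and y | x ~ Bernoulli(logistic <x, theta>),
   the label y = 1 being encoded as true; xsection A x = {y | (x, y) in A}. *)
Definition obs_law (A : set (observation R d)) : \bar R :=
  (\int[std_gaussian]_x label_prob x (xsection A x))%E.

Let measurable_sec (A : set (observation R d)) : measurable A ->
  measurable_fun setT (fun x => label_prob x (xsection A x)).
Proof.
move=> mA; apply: (@measurable_fun_xsection_finite_kernel _ _ _ _ _
  (kprobability measurable_label_prob)).
by rewrite inE.
Qed.

Let obs_law0 : obs_law set0 = 0%E.
Proof.
by apply: integral0_eq => x _; rewrite xsection0 measure0.
Qed.

Let obs_law_ge0 A : (0 <= obs_law A)%E.
Proof. by apply: integral_ge0 => x _; exact: measure_ge0. Qed.

Let obs_law_sigma_additive : semi_sigma_additive obs_law.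
Proof.
move=> F mF tF mUF; apply: cvg_toP.
  apply: is_cvg_ereal_nneg_natsum_cond => n _ _; exact: obs_law_ge0.
rewrite /obs_law -integral_nneseries//.
- apply: eq_integral => x _; rewrite xsection_bigcup.
  apply: cvg_lim => //; apply: measure_sigma_additive.
    by move=> i; exact: measurable_xsection.
  exact: trivIset_xsection.
- by move=> n; exact: measurable_sec.
Qed.

HB.instance Definition _ := isMeasure.Build _ _ _ obs_law
  obs_law0 obs_law_ge0 obs_law_sigma_additive.

Let obs_law_setT : obs_law setT = 1%E.
Proof.
have xsT (x : covariate R d) : xsection [set: observation R d] x = setT.
  by apply/seteqP; split => // y _; rewrite /xsection/= inE.
transitivity (\int[std_gaussian]_x (cst 1 x : \bar R))%E.
  by apply: eq_integral => x _; rewrite xsT probability_setT.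
by rewrite integral_cst// mul1e; exact: probability_setT.
Qed.

HB.instance Definition _ :=
  Measure_isProbability.Build _ _ _ obs_law obs_law_setT.

Definition data_law n : probability (n.-tuple (observation R d)) R :=
  iid obs_law n.

End observation_law.

End logistic_model.

Arguments std_gaussian R d : clear implicits.

(* Main.v *)
(* Le Cam's two-point method with r1 = R0 and r2 = R0 + delta, where delta is a
   small multiple of sqrt (R0^3 / n).  The chi-square divergence of one
   observation under r2 from one under r1 is at most
   delta^2 E[t^2 exp (- R0 |t|)] with t = <x, v>: the Fisher information of the
   radius is only collected on the slab |t| <~ 1/R0, so it is O(1 / R0^3), and
   tensorization keeps the n-sample chi-square bounded.  The law of t is never
   computed: u^2 exp (- |u|) is dominated by a series of Gaussian bumps, and
   E exp (- lam t^2) follows by integrating out one coordinate of x at a time. *)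

Require Import Defs.
From mathcomp Require Import all_boot all_order all_algebra.
From mathcomp Require Import all_classical all_reals all_analysis.
From mathcomp Require Import measurable_realfun ring lra.

Set Implicit Arguments.
Unset Strict Implicit.
Unset Printing Implicit Defensive.

Import Order.TTheory GRing.Theory Num.Theory.

Local Open Scope classical_set_scope.
Local Open Scope ring_scope.

(** * Integration against a measure given by a density *)

Section density.
Context d (T : measurableType d) (R : realType).
Variables (mu nu : {measure set T -> \bar R}) (w : T -> R).
Hypotheses (mw : measurable_fun setT w) (w0 : forall x, 0 <= w x).
Hypothesis nuE : forall A, measurable A ->
  nu A = (\int[mu]_(x in A) (w x)%:E)%E.

Import HBNNSimple.

Let ge0_integral_density_nnsfun (f : {nnsfun T >-> R}) :
  (\int[nu]_x (f x)%:E = \int[mu]_x ((f x)%:E * (w x)%:E))%E.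
Proof.
under [LHS]eq_integral do rewrite fimfunE -fsumEFin//.
rewrite [LHS]ge0_integral_fsum//; last 2 first.
  - by move=> r; exact/measurable_EFinP/measurableT_comp.
  - by move=> n x _; rewrite EFinM nnfun_muleindic_ge0.
under [RHS]eq_integral.
  move=> x xD; rewrite fimfunE -fsumEFin// muleC ge0_mule_fsumr; last first.
    by move=> r; rewrite EFinM nnfun_muleindic_ge0.
  over.
rewrite [RHS]ge0_integral_fsum//; last 2 first.
  - move=> r; apply: emeasurable_funM; first exact/measurable_EFinP.
    by apply/measurable_EFinP; do 2 apply/measurableT_comp => //.
  - move=> i x _; apply: mule_ge0; first by rewrite lee_fin.
    by rewrite EFinM nnfun_muleindic_ge0.
apply: eq_fsbigr => r _.
rewrite integralZl_indic_nnsfun// integral_indic// setIT nuE//.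
have [r0|r0] := ltP r 0.
  rewrite preimage_nnfun0// integral_set0 mule0.
  by rewrite integral0_eq// => x _; rewrite indic0 mulr0 mule0.
rewrite [in LHS]integral_mkcond -ge0_integralZl//; last 2 first.
- apply/(measurable_restrictT _ _).1 => //.
  exact/measurable_EFinP/measurable_funTS.
- by move=> x _; apply: erestrict_ge0 => y _; rewrite lee_fin.
apply: eq_integral => x _; rewrite /patch indicE.
by case: ifP => _; [rewrite mulr1 muleC|rewrite mulr0 !mule0].
Qed.

(** By monotone convergence both sides are limits along the same increasing sequence of simple
    functions, for which the identity reduces to the hypothesis on sets. *)
Lemma ge0_integral_density (f : T -> \bar R) :
  measurable_fun setT f -> (forall x, 0 <= f x)%E ->
  (\int[nu]_x f x = \int[mu]_x (f x * (w x)%:E))%E.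
Proof.
move=> mf f0.
pose f_ := nnsfun_approx measurableT mf.
transitivity (lim (\int[nu]_x (f_ n x)%:E @[n --> \oo])%E).
  rewrite -monotone_convergence//=.
  - apply: eq_integral => x _; apply/esym/cvg_lim => //=.
    exact: cvg_nnsfun_approx.
  - by move=> n; exact/measurable_EFinP.
  - by move=> n x _; rewrite lee_fin.
  - by move=> x _ a b ab; rewrite lee_fin; exact/lefP/nd_nnsfun_approx.
transitivity (lim (\int[mu]_x ((f_ n x)%:E * (w x)%:E)%E @[n --> \oo])%E).
  by apply: congr_lim; apply/funext => n /=; exact: ge0_integral_density_nnsfun.
rewrite -monotone_convergence//=.
- apply: eq_integral => x _; apply/cvg_lim => //=; rewrite muleC.
  under eq_fun do rewrite muleC.
  exact/cvgeZl/cvg_nnsfun_approx.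
- by move=> n; apply: emeasurable_funM; exact/measurable_EFinP.
- by move=> n x _; rewrite mule_ge0 ?lee_fin.
- move=> x _ a b ab; apply: lee_wpmul2r; rewrite lee_fin//.
  exact/lefP/nd_nnsfun_approx.
Qed.

End density.

(** * Product measures: likelihood ratios and tensorization *)

Section iid_integral.
Context {d} {T : measurableType d} {R : realType}.
Implicit Types P Q : probability T R.

Lemma measurable_integral_iid_cons P n (f : n.+1.-tuple T -> \bar R) :
  measurable_fun setT f -> (forall w, 0 <= f w)%E ->
  measurable_fun setT (fun x => \int[iid P n]_w f (cons_pair (x, w)))%E.
Proof.
move=> mf f0.
apply: (@measurable_fun_fubini_tonelli_F _ _ _ _ _ (iid P n)
  (f \o @cons_pair _ T n)) => //.
  by apply: measurableT_comp => //; exact: measurable_cons_pair.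
by move=> x; exact: f0.
Qed.

Lemma ge0_integral_iidS P n (f : n.+1.-tuple T -> \bar R) :
  measurable_fun setT f -> (forall w, 0 <= f w)%E ->
  (\int[iid P n.+1]_w f w =
   \int[P]_x \int[iid P n]_w f (cons_pair (x, w)))%E.
Proof.
move=> mf f0; rewrite /= ge0_integral_distribution// fubini_tonelli1//.
  by apply: measurableT_comp => //; exact: measurable_cons_pair.
by move=> x; exact: f0.
Qed.

(** When [l] is the likelihood ratio of one observation, this is the likelihood ratio of the whole
    sample. *)
Definition prod_tuple (l : T -> R) n (w : n.-tuple T) : R :=
  \prod_(i < n) l (tnth w i).

Lemma prod_tuple_cons l n x (w : n.-tuple T) :
  prod_tuple l (cons_pair (x, w)) = l x * prod_tuple l w.
Proof.
rewrite /prod_tuple big_ord_recl tnth0; congr (_ * _).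
by apply: eq_bigr => i _; rewrite tnthS.
Qed.

Lemma measurable_prod_tuple l n : measurable_fun setT l ->
  measurable_fun setT (@prod_tuple l n).
Proof.
move=> ml; apply: measurable_prod => i _.
by apply: measurableT_comp => //; exact: measurable_tnth.
Qed.

Lemma prod_tuple_ge0 l n (w : n.-tuple T) :
  (forall x, 0 <= l x) -> 0 <= prod_tuple l w.
Proof. by move=> l0; exact: prodr_ge0. Qed.

(** Induction on [n], splitting off the first observation. The density hypothesis is in integral
    form because it is applied to the inner integral, as a function of that observation. *)
Lemma ge0_integral_iid_density P Q (l : T -> R) :
  measurable_fun setT l -> (forall x, 0 <= l x) ->
  (forall g : T -> \bar R, measurable_fun setT g -> (forall x, 0 <= g x)%E ->
    \int[Q]_x g x = \int[P]_x (g x * (l x)%:E))%E ->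
  forall n (g : n.-tuple T -> \bar R),
    measurable_fun setT g -> (forall w, 0 <= g w)%E ->
    (\int[iid Q n]_w g w = \int[iid P n]_w (g w * (prod_tuple l w)%:E))%E.
Proof.
move=> ml l0 QP.
have mL m : measurable_fun setT (fun w : m.-tuple T => (prod_tuple l w)%:E).
  by apply/measurable_EFinP; exact: measurable_prod_tuple.
elim=> [|n IH] g mg g0.
  rewrite !integral_dirac//; first by rewrite /prod_tuple big_ord0 mule1.
  by apply: emeasurable_funM => //; exact: mL.
have mgc x : measurable_fun setT (fun w : n.-tuple T => g (cons_pair (x, w))).
  apply: measurableT_comp => //.
  apply: (@measurable_cons _ _ _ _ (fun=> x) n (fun w => w)).
    exact: measurable_cst.
  exact: measurable_id.
rewrite ge0_integral_iidS// QP; last 2 first.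
- exact: measurable_integral_iid_cons.
- by move=> x; exact: integral_ge0.
rewrite ge0_integral_iidS; last 2 first.
- by apply: emeasurable_funM => //; exact: mL.
- by move=> w; rewrite mule_ge0// lee_fin prod_tuple_ge0.
apply: eq_integral => x _; rewrite IH// muleC -ge0_integralZl//.
- by apply: eq_integral => w _; rewrite prod_tuple_cons EFinM muleCA.
- by apply: emeasurable_funM => //; exact: mL.
- by move=> w _; rewrite mule_ge0// lee_fin prod_tuple_ge0.
- by rewrite lee_fin.
Qed.

(** Used with [l] the squared likelihood ratio: one plus the chi-square divergence is multiplicative
    over independent observations. *)
Lemma integral_iid_prod_tuple P (l : T -> R) n :
  measurable_fun setT l -> (forall x, 0 <= l x) ->
  (\int[iid P n]_w (prod_tuple l w)%:E = (\int[P]_x (l x)%:E) ^+ n)%E.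
Proof.
move=> ml l0.
have mL m :
    measurable_fun setT (fun w : m.-tuple T => (prod_tuple l w)%:E).
  by apply/measurable_EFinP; exact: measurable_prod_tuple.
have L0 m (w : m.-tuple T) : (0 <= (prod_tuple l w)%:E)%E.
  by rewrite lee_fin prod_tuple_ge0.
elim: n => [|n IH].
  rewrite integral_dirac//=; last exact: mL.
  by rewrite /prod_tuple big_ord0 mule1 diracT.
rewrite ge0_integral_iidS// expeS -IH muleC -ge0_integralZl//; last 3 first.
- exact/measurable_EFinP.
- by move=> x _; rewrite lee_fin.
- by apply: integral_ge0 => w _.
apply: eq_integral => x _; rewrite muleC -ge0_integralZl//.
- by apply: eq_integral => w _; rewrite prod_tuple_cons EFinM.
- exact: mL.
- by rewrite lee_fin.
Qed.

End iid_integral.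

(** * Pointwise chi-square bounds for logistic labels *)

Section logistic_chi2.
Context {R : realType}.
Implicit Types a b u : R.

Lemma logistic_ge0 a : 0 <= logistic a.
Proof. by rewrite invr_ge0 addr_ge0 ?expR_ge0. Qed.

Lemma logistic_gt0 a : 0 < logistic a.
Proof. by rewrite invr_gt0 addr_gt0 ?expR_gt0. Qed.

Lemma logistic_lt1 a : logistic a < 1.
Proof. by rewrite invf_lt1 ?ltrDl ?expR_gt0// addr_gt0 ?expR_gt0. Qed.

(** The left side is one plus the chi-square divergence of Bernoulli(s(b)) from Bernoulli(s(a)); in
    [x] and [y] it is a rational function. *)
Lemma logistic_chi2E a b (x := expR (- a)) (y := expR (- b)) :
  logistic b ^+ 2 / logistic a + (1 - logistic b) ^+ 2 / (1 - logistic a) =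
  1 + (x - y) ^+ 2 / (x * (1 + y) ^+ 2).
Proof.
have x0 : x != 0 by rewrite gt_eqF ?expR_gt0.
have x1 : 1 + x != 0 by rewrite gt_eqF// addr_gt0 ?expR_gt0.
have y1 : 1 + y != 0 by rewrite gt_eqF// addr_gt0 ?expR_gt0.
rewrite /logistic -/x -/y.
have -> : 1 - (1 + x)^-1 = x / (1 + x) by field.
field.
by rewrite x0 x1 y1.
Qed.

(** Here [a] and [b] have the same sign, with [b] further from 0, as for one covariate seen at a
    smaller and a larger radius. The inequality 1 + z <= exp z gives x - y <= x (b - a) when b >= 0,
    and y - x <= y (a - b) when b < 0; the factor (1 + y)^2 in the denominator absorbs 1 or y^2
    respectively. *)
Lemma logistic_chi2_le a b : `|a| <= `|b| -> 0 <= a * b ->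
  logistic b ^+ 2 / logistic a + (1 - logistic b) ^+ 2 / (1 - logistic a) <=
  1 + (b - a) ^+ 2 * expR (- `|a|).
Proof.
move=> ab ab0; rewrite logistic_chi2E lerD2l.
set x := expR (- a); set y := expR (- b).
have x0 : 0 < x by exact: expR_gt0.
have y0 : 0 < y by exact: expR_gt0.
rewrite ler_pdivrMr ?mulr_gt0 ?exprn_gt0 ?addr_gt0//.
have [b0|b0] := leP 0 b.
  have a0 : 0 <= a.
    rewrite leNgt; apply/negP => a0; move: ab; rewrite ltr0_norm// ger0_norm//.
    by nra.
  move: ab; rewrite !ger0_norm// => ab.
  have yx : x * (1 - (b - a)) <= y.
    have -> : y = x * expR (- (b - a)) by rewrite -expRD; congr expR; ring.
    by apply: ler_wpM2l; [exact: ltW|exact: expR_ge1Dx].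
  have yx' : y <= x by rewrite ler_expR lerN2.
  have : (x - y) ^+ 2 <= (x * (b - a)) ^+ 2 by rewrite ler_sqr ?nnegrE; nra.
  move=> /le_trans; apply.
  rewrite -/x.
  rewrite [leRHS](_ : _ = ((1 + y) * (x * (b - a))) ^+ 2); last by ring.
  have xb : 0 <= x * (b - a) by nra.
  by rewrite ler_sqr ?nnegrE; nra.
have a0 : a <= 0 by nra.
move: ab; rewrite ler0_norm// ltr0_norm// lerN2 opprK => ab.
have xy : y * (1 - (a - b)) <= x.
  have -> : x = y * expR (- (a - b)) by rewrite -expRD; congr expR; ring.
  by apply: ler_wpM2l; [exact: ltW|exact: expR_ge1Dx].
have xy' : x <= y by rewrite ler_expR lerN2.
have -> : expR a = x^-1 by rewrite /x expRN invrK.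
have : (x - y) ^+ 2 <= (y * (a - b)) ^+ 2.
  by rewrite -[leLHS]sqrrN opprB ler_sqr ?nnegrE; nra.
move=> /le_trans; apply.
rewrite [leRHS](_ : _ = ((1 + y) * (a - b)) ^+ 2).
  by rewrite ler_sqr ?nnegrE; nra.
by field; rewrite gt_eqF.
Qed.

(** At the dyadic scale 2^k comparable to 1 + |u|, the Gaussian bump is at least exp(-1), and
    exp(-|u|) beats the polynomial u^2 4^k. The weight 4^-k leaves a summable 2^-k once a bump of
    width 2^k has been integrated. *)
Lemma dyadic_majorant : exists2 K : R, 0 <= K & forall u, exists k,
  u ^+ 2 * expR (- `|u|) <= K * ((4 ^+ k)^-1 * expR (- (4 ^+ k)^-1 * u ^+ 2)).
Proof.
have K0 : 0 <= 1024 * expR 2 :> R.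
  by apply: mulr_ge0; [exact: ler0n|exact: expR_ge0].
exists (1024 * expR 2) => // u.
(* Take the least k with |u| <= 2^k: minimality bounds 2^k by 2|u|, except when k = 0, where the
   summand 1 is needed. *)
have [k [uk ku]] : exists k, `|u| <= 2 ^+ k /\ 2 ^+ k <= 1 + 2 * `|u|.
  have ex : exists k, `|u| <= 2 ^+ k.
    exists (Num.bound `|u|).
    rewrite (le_trans (ltW (archi_boundP (normr_ge0 u))))//.
    by rewrite -natrX ler_nat ltnW// ltn_expl.
  case: (ex_minnP ex) => -[|k] uk kmin.
    by exists 0%N; split => //; rewrite expr0 lerDl mulr_ge0.
  exists k.+1; split => //.
  have : 2 ^+ k < `|u|.
    by rewrite ltNge; apply/negP => /kmin; rewrite ltnn.
  by rewrite exprS => ku; have := normr_ge0 u; lra.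
exists k.
rewrite -real_normK ?num_real//; move: (normr_ge0 u) uk ku; set v := `|u|.
have -> : 4 ^+ k = (2 ^+ k) ^+ 2 :> R.
  by rewrite -exprM mulnC exprM expr2; congr (_ ^+ k); ring.
set p : R := 2 ^+ k => v0 vp pv.
have p1 : 1 <= p by rewrite exprn_ege1//; lra.
have p0 : 0 < p by exact: lt_le_trans p1.
(* The fourth power of z <= exp z at z = (1 + v) / 4. With p <= 2 (1 + v) this yields the constant
   1024 = 4 * 256. *)
have E : ((1 + v) / 4) ^+ 4 <= expR 1 * expR v.
  rewrite -expRD; have -> : 1 + v = 4%:R * ((1 + v) / 4) by field.
  rewrite expRM_natl lerXn2r ?nnegrE ?expR_ge0//; first by lra.
  by apply: le_trans (expR_ge1Dx _); lra.
have E' : v ^+ 2 * p ^+ 2 <= 1024 * (expR 1 * expR v).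
  have h1 : v ^+ 2 * p ^+ 2 <= (1 + v) ^+ 2 * (2 * (1 + v)) ^+ 2.
    by rewrite ler_pM ?sqr_ge0// ler_sqr ?nnegrE; lra.
  apply: (le_trans h1); move: E; set Z := expR 1 * _.
  by rewrite expr_div_n => E; have : (1 + v) ^+ 4 <= 256 * Z; [lra|nra].
have F : expR (- 1) <= expR (- (p ^+ 2)^-1 * v ^+ 2).
  rewrite ler_expR mulNr lerN2 mulrC ler_pdivrMr ?exprn_gt0// mul1r.
  by rewrite ler_sqr ?nnegrE// ltW.
apply: (@le_trans _ _ (1024 * expR 2 * ((p ^+ 2)^-1 * expR (- 1)))); last first.
  apply: (ler_wpM2l K0); apply: ler_wpM2l => //.
  by rewrite invr_ge0 sqr_ge0.
have -> : expR 2 = expR 1 ^+ 2 :> R by rewrite -expRM_natl mulr1.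
rewrite !expRN; move: (expR_gt0 v) (expR_gt0 (1 : R)) E'.
move: (expR v) (expR 1) => X Y X0 Y0 E'.
rewrite ler_pdivrMr// [leRHS](_ : _ = 1024 * (Y * X) / p ^+ 2).
  by rewrite ler_pdivlMr// exprn_gt0.
by field; rewrite !gt_eqF.
Qed.

End logistic_chi2.

(** * Exponential moments of squared Gaussian linear forms *)

Section gaussian_exponential_moment.
Context {R : realType}.
Implicit Types lam s a : R.
Local Notation G := (normal_prob (0 : R) 1).

Lemma integral_normal_prob (m sigma : R) (f : R -> \bar R) :
  measurable_fun setT f -> (forall x, 0 <= f x)%E ->
  (\int[normal_prob m sigma]_x f x =
   \int[lebesgue_measure]_x (f x * (normal_pdf m sigma x)%:E))%E.
Proof.
move=> mf f0; apply: ge0_integral_density => //.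
- exact: measurable_normal_pdf.
- exact: normal_pdf_ge0.
Qed.

Lemma measurable_gauss_factor (lam s a : R) :
  measurable_fun setT (fun x : R => (expR (- lam * (s + x * a) ^+ 2))%:E).
Proof.
apply/measurable_EFinP; apply: measurableT_comp => //.
apply: measurable_funM => //; apply: measurable_funX.
apply: measurable_funD => //.
exact: measurable_funM.
Qed.

(** Completing the square: the integrand times the standard density is a constant times the normal
    density of mean [m] and variance 1/D. *)
Lemma normal_exp_sqr lam s a : 0 <= lam ->
  (\int[G]_x (expR (- lam * (s + x * a) ^+ 2))%:E =
   ((Num.sqrt (1 + 2 * lam * a ^+ 2))^-1 *
    expR (- (lam / (1 + 2 * lam * a ^+ 2)) * s ^+ 2))%:E)%E.
Proof.
move=> lam0; set D := 1 + 2 * lam * a ^+ 2.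
have D0 : 0 < D by have := mulr_ge0 lam0 (sqr_ge0 a); rewrite /D; nra.
have sD0 : 0 < Num.sqrt D by rewrite sqrtr_gt0.
have sqD : Num.sqrt D ^+ 2 = D by rewrite sqr_sqrtr ?ltW.
set m := - (2 * lam * a * s) / D.
rewrite integral_normal_prob; last 2 first.
- exact: measurable_gauss_factor.
- by move=> x; rewrite lee_fin expR_ge0.
set c := _ * expR _.
transitivity (\int[lebesgue_measure]_x
    (c%:E * (normal_pdf m (Num.sqrt D)^-1 x)%:E))%E; last first.
  rewrite ge0_integralZl//.
  - by rewrite integral_normal_pdf mule1.
  - by apply/measurable_EFinP; exact: measurable_normal_pdf.
  - by move=> x _; rewrite lee_fin normal_pdf_ge0.
  - by rewrite lee_fin mulr_ge0 ?expR_ge0// invr_ge0.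
apply: eq_integral => x _; rewrite -!EFinM; congr EFin.
rewrite !normal_pdfE ?oner_neq0 ?invr_neq0 ?gt_eqF//.
have peak : normal_peak (Num.sqrt D)^-1 = Num.sqrt D * normal_peak (1 : R).
  rewrite /normal_peak exprVn sqD expr1n mul1r -mulrnAr.
  by rewrite sqrtrM ?invr_ge0 ?ltW// sqrtrV ?ltW// invfM invrK.
rewrite peak /normal_fun /c.
rewrite exprVn sqD.
set q := Num.sqrt D; set n1 := normal_peak 1.
set E1 := expR (- (lam / D) * _); set E2 := expR (- (x - m) ^+ 2 / _).
have -> : q^-1 * E1 * (q * n1 * E2) = n1 * (E1 * E2) by field; rewrite gt_eqF.
rewrite mulrCA /E1 /E2 -!expRD; congr (_ * expR _).
by rewrite /m /D; field; rewrite gt_eqF.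
Qed.

Lemma measurable_iid_gauss_factor d lam s (a : 'I_d -> R) :
  measurable_fun setT (fun x : covariate R d =>
    (expR (- lam * (s + \sum_(i < d) (tnth x i : R) * a i) ^+ 2))%:E).
Proof.
apply/measurable_EFinP; apply: measurableT_comp => //.
apply: measurable_funM => //; apply: measurable_funX.
apply: measurable_funD => //.
apply: measurable_sum => i; apply: measurable_funM => //.
exact: measurable_tnth.
Qed.

(** Induction on [d]. The offset [s] is general so that it can absorb the first coordinate:
    integrating out the others leaves a function of the same form with [lam] replaced by lam / (1 +
    2 lam A), to which the one-dimensional formula applies. *)
Lemma iid_normal_exp_sqr d lam s (a : 'I_d -> R) : 0 <= lam ->
  (\int[iid G d]_(x in [set: covariate R d])
     (expR (- lam * (s + \sum_(i < d) (tnth x i : R) * a i) ^+ 2))%:E =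
   ((Num.sqrt (1 + 2 * lam * (\sum_(i < d) a i ^+ 2)))^-1 *
    expR (- (lam / (1 + 2 * lam * (\sum_(i < d) a i ^+ 2))) * s ^+ 2))%:E)%E.
Proof.
move=> lam0; elim: d => [|d IH] in s a *.
  rewrite integral_dirac; last 2 first.
  - exact: measurableT.
  - exact: measurable_iid_gauss_factor.
  rewrite /= !big_ord0 diracT mul1e; congr EFin.
  by rewrite mulr0 !addr0 sqrtr1 invr1 mul1r mulr1.
rewrite ge0_integral_iidS; last 2 first.
- exact: measurable_iid_gauss_factor.
- by move=> x; rewrite lee_fin expR_ge0.
set A := \sum_(i < d) a (lift ord0 i) ^+ 2.
have A0 : 0 <= A by apply: sumr_ge0 => i _; exact: sqr_ge0.
have D0 : 0 < 1 + 2 * lam * A by nra.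
transitivity (\int[G]_x ((Num.sqrt (1 + 2 * lam * A))^-1%:E *
    (expR (- (lam / (1 + 2 * lam * A)) * (s + x * a ord0) ^+ 2))%:E)%E)%E.
  apply: eq_integral => x _; rewrite -EFinM -IH; apply: eq_integral => w _.
  rewrite big_ord_recl tnth0 addrA; congr ((expR (_ * (_ + _) ^+ 2))%:E).
  by apply: eq_bigr => i _; rewrite tnthS.
rewrite ge0_integralZl//; last exact: measurable_gauss_factor.
rewrite normal_exp_sqr; last by rewrite divr_ge0// ltW.
rewrite -EFinM big_ord_recl -/A; congr EFin.
rewrite [LHS]mulrA -invfM -sqrtrM ?ltW//.
congr ((Num.sqrt _)^-1 * expR (- _ * _)).
  by field; rewrite gt_eqF.
field; rewrite !gt_eqF//=.
have : 0 <= lam * (a ord0 ^+ 2 + A) by rewrite mulr_ge0// addr_ge0// sqr_ge0.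
by lra.
Qed.

End gaussian_exponential_moment.

(** * The second moment localized to the slab of width 1/r *)

Section gaussian_small_ball.
Context {R : realType}.

Lemma dotpZ d (x : covariate R d) (r : R) (v : 'rV[R]_d) :
  dotp x (r *: v) = r * dotp x v.
Proof.
by rewrite /dotp mulr_sumr; apply: eq_bigr => i _; rewrite mxE mulrCA.
Qed.

Lemma std_gaussian_dotp_exp_sqr d (v : 'rV[R]_d) (lam : R) : 0 <= lam ->
  l2norm v = 1 ->
  (\int[std_gaussian R d]_x (expR (- lam * dotp x v ^+ 2))%:E =
   ((Num.sqrt (1 + 2 * lam))^-1)%:E)%E.
Proof.
move=> lam0 v1.
have v2 : \sum_(i < d) v ord0 i ^+ 2 = 1.
  rewrite -[RHS](expr1n _ 2) -v1 sqr_sqrtr//.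
  by apply: sumr_ge0 => i _; exact: sqr_ge0.
have := iid_normal_exp_sqr 0 (v ord0) lam0.
rewrite v2 mulr1 expr0n/= mulr0 expR0 mulr1 => <-.
by apply: eq_integral => x _; rewrite add0r.
Qed.

Lemma measurable_std_gaussian_dotp_exp_sqr d (v : 'rV[R]_d) (lam : R) :
  measurable_fun setT
    (fun x : covariate R d => (expR (- lam * dotp x v ^+ 2))%:E).
Proof.
apply/measurable_EFinP; apply: measurableT_comp => //.
apply: measurable_funM => //; apply: measurable_funX; exact: measurable_dotp.
Qed.

(** The k-th bump of the dyadic majorant has integral at most K 4^-k 2^k / r, and these bounds sum
    to 2K/r, uniformly in the dimension and the direction. *)
Lemma std_gaussian_localized_moment : exists2 K : R, 0 <= K &
  forall d (v : 'rV[R]_d) (r : R), l2norm v = 1 -> 0 < r ->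
  (\int[std_gaussian R d]_x
     ((r * dotp x v) ^+ 2 * expR (- `|r * dotp x v|))%:E <= (K / r)%:E)%E.
Proof.
have [K K0 hK] := @dyadic_majorant R.
exists (2 * K) => [|d v r v1 r0]; first by rewrite mulr_ge0.
pose lam k : R := (4 ^+ k)^-1 * r ^+ 2.
have lam0 k : 0 <= lam k by rewrite mulr_ge0 ?invr_ge0 ?exprn_ge0// ltW.
pose c k : R := K * (4 ^+ k)^-1.
have c0 k : 0 <= c k by rewrite mulr_ge0// invr_ge0 exprn_ge0.
pose F k (x : covariate R d) : \bar R :=
  ((c k)%:E * (expR (- lam k * dotp x v ^+ 2))%:E)%E.
have F0 k x : (0 <= F k x)%E by rewrite mule_ge0// lee_fin// expR_ge0.
have mF k : measurable_fun setT (F k).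
  by apply: emeasurable_funM => //; exact: measurable_std_gaussian_dotp_exp_sqr.
apply: (@le_trans _ _ (\int[std_gaussian R d]_x (\sum_(k <oo) F k x))%E).
  apply: ge0_le_integral => //.
  - by move=> x _; rewrite lee_fin mulr_ge0 ?sqr_ge0 ?expR_ge0.
  - apply/measurable_EFinP; apply: measurable_funM.
      apply: measurable_funX; apply: measurable_funM => //.
      exact: measurable_dotp.
    apply: measurableT_comp => //; apply: measurableT_comp => //.
    apply: measurableT_comp => //; apply: measurable_funM => //.
    exact: measurable_dotp.
  - exact: ge0_emeasurable_sum.
  - move=> x _; have [k hk] := hK (r * dotp x v).
    apply: (@le_trans _ _ (F k x)).
      rewrite /F -EFinM lee_fin (le_trans hk)// /c /lam mulrA exprMn.
      by rewrite !mulNr -!mulrA.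
    (* The partial sum up to [k.+1], exclusive, is the first to contain the term [F k x]. *)
    apply: le_trans (nneseries_lim_ge k.+1 _); last by move=> n _ _; exact: F0.
    by rewrite big_nat_recr//= leeDr// sume_ge0.
rewrite integral_nneseries//.
(* Writing the bound as a geometric series reduces the claim to a termwise comparison. *)
have -> : (2 * K / r)%:E = (\sum_(k <oo) (2 * K / r / (2 ^ (k + 1))%:R)%:E)%E.
  have /cvg_lim := @cvg_geometric_eseries_half R (2 * K / r) 0.
  by rewrite expr0 divr1 => <-.
apply: lee_nneseries => [k _ _|k _].
  by apply: integral_ge0 => x _; exact: F0.
rewrite ge0_integralZl ?lee_fin//; last first.
  exact: measurable_std_gaussian_dotp_exp_sqr.
rewrite std_gaussian_dotp_exp_sqr// -EFinM lee_fin.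
have p0 : 0 < 2 ^+ k :> R by exact: exprn_gt0.
(* Indeed r / 2^k is the square root of [lam k]. *)
have sq : r / 2 ^+ k <= Num.sqrt (1 + 2 * lam k).
  have q0 : 0 <= r / 2 ^+ k by rewrite divr_ge0// ltW.
  rewrite -(ger0_norm q0) -sqrtr_sqr ler_sqrt.
    rewrite expr_div_n -exprM mulnC exprM /lam.
    have -> : 2 ^+ 2 = 4 :> R by rewrite expr2; lra.
    have := lam0 k; rewrite /lam [_ * r ^+ 2]mulrC; lra.
  by have := lam0 k; lra.
rewrite natrX addn1 exprS.
have -> : 2 * K / r / (2 * 2 ^+ k) = c k / (r / 2 ^+ k).
  rewrite /c; have -> : 4 ^+ k = (2 ^+ k) ^+ 2 :> R.
    by rewrite -exprM mulnC exprM expr2; congr (_ ^+ k); lra.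
  by field; rewrite !gt_eqF.
by rewrite ler_wpM2l// lef_pV2 ?posrE ?divr_gt0// (lt_le_trans _ sq)// divr_gt0.
Qed.

End gaussian_small_ball.

(** * Likelihood ratio of one observation *)

Section obs_law_density.
Context {R : realType} (d : nat).
Implicit Types (theta : 'rV[R]_d) (z : observation R d).

Definition label_weight (p : R) (y : bool) : R := if y then p else 1 - p.

Definition obs_weight theta z : R :=
  label_weight (logistic (dotp z.1 theta)) z.2.

Lemma obs_weight_gt0 theta z : 0 < obs_weight theta z.
Proof.
rewrite /obs_weight /label_weight; case: ifP => _; first exact: logistic_gt0.
by rewrite subr_gt0 logistic_lt1.
Qed.

Lemma measurable_obs_weight theta : measurable_fun setT (obs_weight theta).
Proof.
have mp : measurable_fun setT
    (fun z : observation R d => logistic (dotp z.1 theta)).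
  apply: measurableT_comp; first exact: measurable_logistic.
  apply: (measurableT_comp (measurable_dotp theta)) => //.
apply: measurable_fun_ifT => //.
exact: measurable_funB.
Qed.

(** A reference measure dominating all [obs_law theta] at once: the label is a fair coin independent
    of the covariate, whence the factor 2 in the densities below. *)
Definition coin_law : probability (observation R d) R :=
  (std_gaussian R d \x bernoulli_prob (2^-1 : R))%E.

Lemma ge0_integral_coin_law (f : observation R d -> \bar R) :
  measurable_fun setT f -> (forall z, 0 <= f z)%E ->
  (\int[coin_law]_z f z = \int[std_gaussian R d]_x
    ((2^-1)%:E * f (x, true) + (2^-1)%:E * f (x, false)))%E.
Proof.
move=> mf f0; rewrite fubini_tonelli1//; apply: eq_integral => x _.
rewrite /fubini_F integral_bernoulli_prob//; last by lra.
by congr (_ + _%:E * _)%E; apply: (_ : 1 - 2^-1 = 2^-1); lra.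
Qed.

Lemma obs_law_density theta A : measurable A ->
  obs_law theta A = (\int[coin_law]_(z in A) (2 * obs_weight theta z)%:E)%E.
Proof.
move=> mA; rewrite integral_mkcond ge0_integral_coin_law; last 2 first.
- apply/(measurable_restrictT _ _).1 => //.
  apply/measurable_EFinP/measurable_funTS; apply: measurable_funM => //.
  exact: measurable_obs_weight.
- move=> z; apply: erestrict_ge0 => y _.
  by rewrite lee_fin mulr_ge0// ltW// obs_weight_gt0.
apply: eq_integral => x _.
have p01 : 0 <= logistic (dotp x theta) <= 1.
  by rewrite ltW ?logistic_gt0//= ltW ?logistic_lt1.
rewrite [LHS](bernoulli_probE p01).
rewrite !diracE !mem_xsection /patch /obs_weight/=.
by case: ifP => _; case: ifP => _;
  rewrite ?mule0 ?mule1 -?EFinM ?mulKf ?adde0 ?add0e.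
Qed.

Lemma ge0_integral_obs_law theta (f : observation R d -> \bar R) :
  measurable_fun setT f -> (forall z, 0 <= f z)%E ->
  (\int[obs_law theta]_z f z =
   \int[coin_law]_z (f z * (2 * obs_weight theta z)%:E))%E.
Proof.
move=> mf f0; apply: ge0_integral_density => //.
- by apply: measurable_funM => //; exact: measurable_obs_weight.
- by move=> z; rewrite mulr_ge0// ltW// obs_weight_gt0.
- exact: obs_law_density.
Qed.

Definition obs_ratio theta1 theta2 z : R :=
  obs_weight theta2 z / obs_weight theta1 z.

Lemma obs_ratio_ge0 theta1 theta2 z : 0 <= obs_ratio theta1 theta2 z.
Proof. by rewrite divr_ge0// ltW// obs_weight_gt0. Qed.

Lemma measurable_obs_ratio theta1 theta2 :
  measurable_fun setT (obs_ratio theta1 theta2).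
Proof.
apply: measurable_funM; first exact: measurable_obs_weight.
(* On positive values inversion is the real power -1, which is measurable. *)
rewrite (_ : (fun z => _) = (@powR R ^~ (-1)) \o obs_weight theta1).
  by apply: measurableT_comp;
    [exact: measurable_powR|exact: measurable_obs_weight].
by apply/funext => z; rewrite /= powR_inv1// ltW// obs_weight_gt0.
Qed.

(** Both integrals are moved to [coin_law], where the positive weight of [theta1] cancels. *)
Lemma obs_law_change theta1 theta2 (f : observation R d -> \bar R) :
  measurable_fun setT f -> (forall z, 0 <= f z)%E ->
  (\int[obs_law theta2]_z f z =
   \int[obs_law theta1]_z (f z * (obs_ratio theta1 theta2 z)%:E))%E.
Proof.
move=> mf f0; transitivity (\int[coin_law]_z
    ((f z * (obs_ratio theta1 theta2 z)%:E) * (2 * obs_weight theta1 z)%:E))%E.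
  transitivity (\int[coin_law]_z (f z * (2 * obs_weight theta2 z)%:E))%E.
    exact: ge0_integral_obs_law.
  apply: eq_integral => z _; rewrite -muleA -EFinM; congr (_ * _%:E)%E.
  by rewrite /obs_ratio; field; rewrite gt_eqF// obs_weight_gt0.
symmetry; apply: ge0_integral_obs_law.
  apply: emeasurable_funM => //; apply/measurable_EFinP.
  exact: measurable_obs_ratio.
by move=> z; rewrite mule_ge0// lee_fin obs_ratio_ge0.
Qed.

Lemma measurable_logistic_chi2 theta1 theta2 :
  measurable_fun setT (fun x : covariate R d =>
    (logistic (dotp x theta2) ^+ 2 / logistic (dotp x theta1) +
     (1 - logistic (dotp x theta2)) ^+ 2 / (1 - logistic (dotp x theta1)))%:E).
Proof.
have m y : measurable_fun setT (fun x : covariate R d =>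
    obs_ratio theta1 theta2 (x, y) * obs_weight theta2 (x, y)).
  apply: measurable_funM; apply: measurable_fun_pair1.
    exact: measurable_obs_ratio.
  exact: measurable_obs_weight.
apply/measurable_EFinP.
rewrite (_ : (fun x => _) =
  (fun x => obs_ratio theta1 theta2 (x, true) * obs_weight theta2 (x, true)) \+
  (fun x => obs_ratio theta1 theta2 (x, false) * obs_weight theta2 (x, false))).
  exact: measurable_funD.
apply/funext => x; rewrite /= /obs_ratio /obs_weight /label_weight/=.
by congr (_ + _); rewrite expr2 mulrAC.
Qed.

(** Given the covariate, averaging the squared ratio over the label under [theta1] gives the sum of
    w2^2 / w1 over the two labels, w1 and w2 being the label weights. *)
Lemma integral_sqr_obs_ratio theta1 theta2 :
  (\int[obs_law theta1]_z (obs_ratio theta1 theta2 z ^+ 2)%:E =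
   \int[std_gaussian R d]_x
     (logistic (dotp x theta2) ^+ 2 / logistic (dotp x theta1) +
      (1 - logistic (dotp x theta2)) ^+ 2 / (1 - logistic (dotp x theta1)))%:E)%E.
Proof.
have m2 : measurable_fun setT (fun z => (obs_ratio theta1 theta2 z ^+ 2)%:E).
  apply/measurable_EFinP; apply: measurable_funX.
  exact: measurable_obs_ratio.
rewrite ge0_integral_obs_law//; last by move=> z; rewrite lee_fin sqr_ge0.
rewrite ge0_integral_coin_law; last 2 first.
- apply: emeasurable_funM => //; apply/measurable_EFinP.
  by apply: measurable_funM => //; exact: measurable_obs_weight.
- move=> z; rewrite mule_ge0 ?lee_fin ?sqr_ge0//.
  by rewrite mulr_ge0// ltW// obs_weight_gt0.
apply: eq_integral => x _; rewrite -!EFinM -EFinD; congr EFin.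
rewrite /obs_ratio /obs_weight /label_weight/=.
have := logistic_lt1 (dotp x theta1); have := logistic_gt0 (dotp x theta1).
move: (logistic _) => p p0 p1.
by field; rewrite !gt_eqF ?subr_gt0.
Qed.

End obs_law_density.

(** * Le Cam's two-point inequality under a chi-square bound *)

Section le_cam.
Context d (T : measurableType d) (R : realType).
Variables (P Q : probability T R) (L f g : T -> R) (delta : R).
Hypotheses (mL : measurable_fun setT L) (mf : measurable_fun setT f).
Hypothesis mg : measurable_fun setT g.
Hypotheses (L0 : forall x, 0 <= L x) (f0 : forall x, 0 <= f x).
Hypothesis g0 : forall x, 0 <= g x.
Hypotheses (delta0 : 0 <= delta) (fg : forall x, delta <= f x + g x).
Hypothesis PQ : forall h : T -> \bar R, measurable_fun setT h ->
  (forall x, 0 <= h x)%E -> (\int[Q]_x h x = \int[P]_x (h x * (L x)%:E))%E.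
Hypothesis L2 : (\int[P]_x (L x ^+ 2)%:E <= (5 / 4)%:E)%E.

(** Integrating f + g L >= delta min(1, L) >= delta (2 L - L^2 - 1/4) under [P], where [L] has mean
    1 and second moment at most 5/4, leaves delta (2 - 5/4 - 1/4) = delta / 2. *)
Lemma le_cam_two_point :
  ((delta / 2)%:E <= \int[P]_x (f x)%:E + \int[Q]_x (g x)%:E)%E.
Proof.
have EL : (\int[P]_x (L x)%:E = 1)%E.
  rewrite -[RHS](@probability_setT _ _ _ Q) -[RHS]mul1e -integral_cst// PQ//.
  by apply: eq_integral => x _; rewrite mul1e.
have mgL : measurable_fun setT (fun x => (g x * L x)%:E).
  by apply/measurable_EFinP; exact: measurable_funM.
have mL2 : measurable_fun setT (fun x => (L x ^+ 2)%:E).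
  by apply/measurable_EFinP; exact: measurable_funX.
rewrite PQ//; last by exact/measurable_EFinP.
have -> : (\int[P]_x ((g x)%:E * (L x)%:E) = \int[P]_x (g x * L x)%:E)%E.
  by apply: eq_integral => x _; rewrite EFinM.
have main : ((2 * delta)%:E <= \int[P]_x (f x)%:E + \int[P]_x (g x * L x)%:E +
    (delta%:E * \int[P]_x (L x ^+ 2)%:E + (delta / 4)%:E))%E.
  have -> : (2 * delta)%:E = (\int[P]_x (2 * delta * L x)%:E)%E.
    under eq_integral do rewrite EFinM.
    rewrite ge0_integralZl//; last 3 first.
    - exact/measurable_EFinP.
    - by move=> x _; rewrite lee_fin.
    - by rewrite lee_fin mulr_ge0.
    by rewrite EL mule1.
  have -> : (delta / 4)%:E = (\int[P]_x (cst (delta / 4)%:E x))%E.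
    rewrite integral_cst// -[LHS]mule1; congr (_ * _)%E.
    exact/esym/probability_setT.
  rewrite -ge0_integralZl//; last by move=> x _; rewrite lee_fin sqr_ge0.
  have mF : measurable_fun setT (fun x => (f x)%:E) by exact/measurable_EFinP.
  have mdL2 : measurable_fun setT (fun x => delta%:E * (L x ^+ 2)%:E)%E.
    exact: measurable_funeM.
  have F0 x : (0 <= (f x)%:E)%E by rewrite lee_fin.
  have gL0 x : (0 <= (g x * L x)%:E)%E by rewrite lee_fin mulr_ge0.
  have dL20 x : (0 <= delta%:E * (L x ^+ 2)%:E)%E.
    by rewrite mule_ge0// lee_fin// sqr_ge0.
  have d40 x : (0 <= cst (delta / 4)%:E x :> \bar R)%E.
    by rewrite lee_fin divr_ge0.
  rewrite -!ge0_integralD//; try (by apply: emeasurable_funD);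
    try (by move=> x _; apply: adde_ge0).
  apply: ge0_le_integral => //.
  - by move=> x _; rewrite lee_fin !mulr_ge0.
  - by apply/measurable_EFinP; exact: measurable_funM.
  - by apply: emeasurable_funD; apply: emeasurable_funD.
  - move=> x _; rewrite -EFinM -!EFinD lee_fin.
    (* f + g t >= delta min(1, t), and min(1, t) + t^2 + 1/4 - 2 t is at least
       (|t - 1| - 1/2)^2, where t = L x. *)
    have := fg x; have := f0 x; have := g0 x; have := L0 x; move: delta0.
    move: (f x) (g x) (L x) => u w t d0 t0 w0 u0 uw.
    have [t1|t1] := leP t 1.
      have h : delta * t <= u + w * t by nra.
      have := mulr_ge0 d0 (sqr_ge0 (t - 1 / 2)).
      by nra.
    have h : delta <= u + w * t by nra.
    have := mulr_ge0 d0 (sqr_ge0 (t - 1)).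
    by nra.
have L2' : (delta%:E * \int[P]_x (L x ^+ 2)%:E <= (delta * (5 / 4))%:E)%E.
  by rewrite EFinM lee_wpmul2l.
have := le_trans main (leeD2l _ (leeD2r _ L2')).
(* Only real constants are moved across the inequality, as the two risks may be infinite. *)
rewrite -EFinD -leeBlDr// -EFinB => /(le_trans _); apply.
by rewrite lee_fin; lra.
Qed.

End le_cam.

(** * Chi-square divergence between two radii for one observation *)

Lemma obs_law_chi2 (R : realType) : exists2 K : R, 0 <= K &
  forall d (v : 'rV[R]_d) (r delta : R), l2norm v = 1 -> 0 < r -> 0 <= delta ->
  (\int[obs_law (r *: v)]_z (obs_ratio (r *: v) ((r + delta) *: v) z ^+ 2)%:E
    <= (1 + K * (delta ^+ 2 / r ^+ 3))%:E)%E.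
Proof.
have [K K0 hK] := @std_gaussian_localized_moment R.
exists K => // d v r delta v1 r0 delta0.
pose h (x : covariate R d) : \bar R :=
  ((r * dotp x v) ^+ 2 * expR (- `|r * dotp x v|))%:E.
have mh : measurable_fun setT h.
  have mr : measurable_fun setT (fun x : covariate R d => r * dotp x v).
    by apply: measurable_funM => //; exact: measurable_dotp.
  apply/measurable_EFinP; apply: measurable_funM; first exact: measurable_funX.
  by do 2 apply: measurableT_comp => //; apply: measurableT_comp.
have h0 x : (0 <= h x)%E by rewrite lee_fin mulr_ge0 ?sqr_ge0 ?expR_ge0.
have m0 : 0 <= (delta / r) ^+ 2 by exact: sqr_ge0.
rewrite integral_sqr_obs_ratio.
apply: (@le_trans _ _ (\int[std_gaussian R d]_x
    (cst 1 x + ((delta / r) ^+ 2)%:E * h x))%E).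
  apply: ge0_le_integral => //.
  - move=> x _; rewrite lee_fin addr_ge0// divr_ge0 ?sqr_ge0 ?logistic_ge0//.
    by rewrite subr_ge0 ltW// logistic_lt1.
  - exact: measurable_logistic_chi2.
  - by apply: emeasurable_funD => //; exact: measurable_funeM.
  - move=> x _; rewrite /h -EFinM -EFinD lee_fin !dotpZ.
    set t := dotp x v.
    (* The increment delta t is rescaled to (delta / r) (r t), so that the localized moment, of
       order 1/r, yields delta^2 / r^3. *)
    have -> : (delta / r) ^+ 2 * ((r * t) ^+ 2 * expR (- `|r * t|)) =
      ((r + delta) * t - r * t) ^+ 2 * expR (- `|r * t|).
      by field; rewrite gt_eqF.
    apply: logistic_chi2_le.
      rewrite !normrM ler_wpM2r// (gtr0_norm r0) gtr0_norm; lra.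
    have -> : r * t * ((r + delta) * t) = r * (r + delta) * t ^+ 2 by ring.
    apply: mulr_ge0; last exact: sqr_ge0.
    by apply: mulr_ge0; lra.
rewrite ge0_integralD//; last 2 first.
- by move=> x _; rewrite mule_ge0.
- exact: measurable_funeM.
rewrite integral_cst// mul1e [X in (X + _)%E]probability_setT ge0_integralZl//.
rewrite EFinD leeD2l//.
have -> : K * (delta ^+ 2 / r ^+ 3) = (delta / r) ^+ 2 * (K / r).
  by field; rewrite gt_eqF.
by rewrite [X in (_ <= X)%E]EFinM lee_wpmul2l// hK.
Qed.

(** * Minimax lower bound for the radius *)

Theorem theorem2p1 (R : realType) :
  exists c C : R, 0 < c /\ c < C /\
  forall (d n : nat) (R0 : R) (v : 'rV[R]_d),
    1 <= R0 -> l2norm v = 1 -> C * R0 <= n%:R ->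
    ((c * Num.sqrt (R0 ^+ 3 / n%:R))%:E <=
     ereal_inf [set ereal_sup
         [set 'E_(data_law (r *: v) n)[(fun w => `|Rt w - r|)%R]
            | r in [set` `[R0, 2 * R0]%R]]
       | Rt in [set: {mfun n.-tuple (observation R d) >-> R}]])%E.
Proof.
have [K K0 chi2] := obs_law_chi2 R.
(* This choice makes both c <= 1 and c K <= 1/8 hold, even if K = 0. *)
pose c : R := (8 * (K + 1))^-1.
have c0 : 0 < c by rewrite invr_gt0 mulr_gt0// ltr_wpDl.
have cK : c * K <= 1 / 8.
  rewrite /c mulrC ler_pdivrMr; last by rewrite mulr_gt0// ltr_wpDl.
  by lra.
have c1 : c <= 1.
  by rewrite invf_le1 ?mulr_gt0 ?ltr_wpDl//; lra.
(* With delta = c sqrt(R0^3 / n), the two risks add up to at least delta / 2, so the larger one is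
   at least delta / 4. *)
exists (c / 4), 1; split; first by rewrite divr_gt0.
split; first by lra.
move=> d n R0 v R1 v1; rewrite mul1r => nR0.
have R00 : 0 < R0 by lra.
have n0 : 0 < n%:R :> R by lra.
set q := R0 ^+ 3 / n%:R.
have q0 : 0 <= q by rewrite divr_ge0 ?exprn_ge0// ltW.
pose delta := c * Num.sqrt q.
have delta0 : 0 <= delta by rewrite mulr_ge0 ?sqrtr_ge0// ltW.
have delta2 : delta ^+ 2 = c ^+ 2 * q by rewrite exprMn sqr_sqrtr.
(* This keeps the second radius R0 + delta inside [R0, 2 R0]; it is where n >= R0 enters, through
   R0^3 / n <= R0^2. *)
have deltaR : delta <= R0.
  rewrite -ler_sqr ?nnegrE ?(ltW R00)// delta2.
  have : q <= R0 ^+ 2.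
    by rewrite ler_pdivrMr// exprSr ler_wpM2l// sqr_ge0.
  have : c ^+ 2 <= 1 by rewrite expr_le1// ltW.
  by nra.
apply/ereal_infP => _ [Rt _ <-].
set S := ereal_sup _.
pose risk r : \bar R := ('E_(data_law (r *: v) n)[(fun w => `|Rt w - r|)%R])%E.
have riskS r : R0 <= r <= 2 * R0 -> (risk r <= S)%E.
  by move=> rR; apply: ereal_sup_ubound; exists r.
have mRt r : measurable_fun setT (fun w => `|Rt w - r|).
  by apply: measurableT_comp => //; exact: measurable_funB.
suff lb : ((delta / 2)%:E <= risk R0 + risk (R0 + delta)%R)%E.
  rewrite leNgt; apply/negP => Slt.
  have h1 : (risk R0 < (delta / 4)%:E)%E.
    apply: le_lt_trans (riskS _ _) _; first by lra.
    by rewrite /delta mulrAC.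
  have h2 : (risk (R0 + delta)%R < (delta / 4)%:E)%E.
    apply: le_lt_trans (riskS _ _) _; first by lra.
    by rewrite /delta mulrAC.
  have := le_lt_trans lb (lteD h1 h2).
  by rewrite -EFinD lte_fin; lra.
rewrite /risk unlock.
set l := obs_ratio (R0 *: v) ((R0 + delta) *: v).
have ml : measurable_fun setT l by exact: measurable_obs_ratio.
have l0 z : 0 <= l z by exact: obs_ratio_ge0.
apply: (@le_cam_two_point _ _ R (data_law (R0 *: v) n)
  (data_law ((R0 + delta) *: v) n) (@prod_tuple _ _ _ l n)).
- exact: measurable_prod_tuple.
- exact: mRt.
- exact: mRt.
- by move=> w; exact: prod_tuple_ge0.
- by move=> w; exact: normr_ge0.
- by move=> w; exact: normr_ge0.
- exact: delta0.
- move=> w; rewrite [X in _ + X]distrC.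
  apply: le_trans (ler_normD _ _).
  by rewrite (_ : _ + _ = delta) ?ger0_norm//; ring.
- move=> h mh h0.
  apply: (@ge0_integral_iid_density _ _ _ (obs_law (R0 *: v))
    (obs_law ((R0 + delta) *: v)) l ml l0 _ n h mh h0).
  by move=> f mf f0; exact: obs_law_change.
(* It remains to bound the second moment of the sample likelihood ratio by 5/4; it is the n-th power
   of that of one observation. *)
have -> : (\int[data_law (R0 *: v) n]_w (prod_tuple l w ^+ 2)%:E =
    (\int[obs_law (R0 *: v)]_z (l z ^+ 2)%:E) ^+ n)%E.
  rewrite -integral_iid_prod_tuple; last 2 first.
  - exact: measurable_funX.
  - by move=> z; exact: sqr_ge0.
  by apply: eq_integral => w _; rewrite /prod_tuple prodrXl.
have := chi2 d v R0 delta v1 R00 delta0; rewrite -/l.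
set I := (\int[_]_z _)%E; set x := K * _ => Ix.
have I0 : (0 <= I)%E by apply: integral_ge0 => z _; rewrite lee_fin sqr_ge0.
have Ifin : I \is a fin_num by rewrite ge0_fin_numE// (le_lt_trans Ix)// ltry.
rewrite -(fineK Ifin) -EFin_expe lee_fin.
move: Ix; rewrite -{1}(fineK Ifin) lee_fin => Ix.
have x0 : 0 <= x by rewrite mulr_ge0// divr_ge0 ?sqr_ge0 ?exprn_ge0// ltW.
(* The scaling of delta cancels [n] and [R0], leaving c^2 K. *)
have nx : n%:R * x <= 1 / 8.
  have -> : n%:R * x = c * (c * K).
    by rewrite /x delta2 /q; field; rewrite !gt_eqF.
  by nra.
apply: (@le_trans _ _ ((1 + x) ^+ n)).
  by rewrite lerXn2r ?nnegrE ?fine_ge0// addr_ge0.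
apply: (@le_trans _ _ (expR (n%:R * x))).
  by rewrite expRM_natl lerXn2r ?nnegrE ?expR_ge0 ?addr_ge0 ?expR_ge1Dx.
apply: (@le_trans _ _ (expR (1 / 8))); first by rewrite ler_expR.
(* Passing to inverses, exp(-1/8) >= 7/8 >= 4/5. *)
rewrite -[1 / 8]opprK expRN -[leRHS]invrK lef_pV2 ?posrE ?expR_gt0//.
by apply: le_trans (expR_ge1Dx _); lra.
Qed.
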